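(* Let $m\ge3$, and for an integer $r\ge1$ let $\phi_r(x)=x^r$. Then $$\lambda_{\phi_r,m}\le2(2/3)^r.$$ Consequently, with $B_n=\binom{n-1}{2}$, $n\ge3$ and $\varepsilon>0$, the inequality $$\lambda_{\phi_r,m}B_n\le\frac{\varepsilon n}{64}$$ holds whenever $r\ge\left\lceil\log_{3/2}\frac{128B_n}{\varepsilon n}\right\rceil$; and since $B_n\le n^2/2$, the simpler choice $r\ge\left\lceil\log_{3/2}\frac{64n}{\varepsilon}\right\rceil$ is also sufficient.
   Context: For $m\ge3$ put $\mathcal T_m=\{\lceil m/3\rceil,\dots,\lfloor2m/3\rfloor\}$. The central split leakage of a weight function $\phi:[0,1]\to[0,1]$ is $$\lambda_{\phi,m}=\max_{t\in\mathcal T_m}\left[\phi\!\left(\tfrac{t-1}{m}\right)+\phi\!\left(\tfrac{m-t}{m}\right)\right].$$ *)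

(* Defs.v *)
From mathcomp Require Import all_boot all_order all_algebra.
From mathcomp Require Import all_classical all_reals all_analysis.

Set Implicit Arguments.
Unset Strict Implicit.
Unset Printing Implicit Defensive.

Import Order.TTheory GRing.Theory Num.Theory.

Local Open Scope ring_scope.

(* T_m = {ceil(m/3), ..., floor(2m/3)}; in nat, ceil(m/3) is (m + 2) %/ 3. *)
Definition central_splits (m : nat) : seq nat :=
  index_iota ((m + 2) %/ 3) ((2 * m) %/ 3).+1.

(* A weight phi : [0,1] -> [0,1] is represented by a function on R of which
   only the values on [0,1] are used.  As these are nonnegative and T_m is
   nonempty for m >= 3, the base value 0 does not affect the maximum. *)
Definition central_split_leakage (R : realType) (phi : R -> R) (m : nat) : R :=
  \big[Num.max/0]_(t <- central_splits m)
    (phi ((t%:R - 1) / m%:R) + phi ((m%:R - t%:R) / m%:R)).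

Definition power_weight (R : realType) (r : nat) : R -> R := fun x => x ^+ r.

Definition logb (R : realType) (b x : R) : R := ln x / ln b.

(* Main.v *)
Require Import Defs.
From mathcomp Require Import all_boot all_order all_algebra.
From mathcomp Require Import all_classical all_reals all_analysis.
From mathcomp Require Import zify ring lra.

Set Implicit Arguments.
Unset Strict Implicit.
Unset Printing Implicit Defensive.

Import Order.TTheory GRing.Theory Num.Theory.

Local Open Scope ring_scope.

(** A central split has [m/3 <= t <= 2m/3], so both arguments [(t-1)/m] and [(m-t)/m] lie in
    [[0, 2/3]], and each power is at most [(2/3)^r]. Since [2/3] is the inverse of [3/2], the target
    bound follows once [128 B / (eps n) <= (3/2)^r]. [ceil_logb_le_expr] turns a logarithmic
    condition on [r] into such an inequality, and [bin2_pred_le] shows that [64 n / eps] dominates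
    the left side. *)

Lemma power_leakage_le (R : realType) (m r : nat) : (0 < m)%N ->
  central_split_leakage (@power_weight R r) m <= 2 * (2 / 3) ^+ r.
Proof.
move=> m_gt0; have m0 : 0 < m%:R :> R by rewrite ltr0n.
(* [big_seq] keeps the membership of [t] in the range; the base value 0 of the maximum must also
   obey the bound. *)
rewrite /central_split_leakage big_seq; elim/big_rec: _ => [|t y].
  by rewrite mulr_ge0 ?exprn_ge0 // divr_ge0.
rewrite mem_index_iota => /andP[lo hi] ley; rewrite ge_max ley andbT.
have t1 : (1 <= t)%N by lia.
have tm : (t <= m)%N by lia.
(* [lo3] bounds [m - t] by [2m/3], and [hi3] bounds [t - 1]. *)
have lo3 : (m <= 3 * t)%N by lia.
have hi3 : (3 * t <= 2 * m)%N by lia.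
move: t1 tm lo3 hi3; rewrite -!(ler_nat R) !natrM => t1 tm lo3 hi3.
have powle (x : R) : 0 <= x -> 3 * x <= 2 * m%:R ->
    (x / m%:R) ^+ r <= (2 / 3) ^+ r.
  move=> x0 xm; apply: lerXn2r; rewrite ?nnegrE ?divr_ge0 ?(ltW m0) //.
  by rewrite ler_pdivrMr //; lra.
by rewrite mulr_natl mulr2n lerD // powle //; lra.
Qed.

Lemma ceil_logb_le_expr (R : realType) (b x : R) (r : nat) :
  1 < b -> 0 < x -> Num.ceil (logb b x) <= r%:Z -> x <= b ^+ r.
Proof.
move=> b1 x0; have b0 : 0 < b by exact: lt_trans b1.
rewrite ceil_le_int /logb ler_pdivrMr ?ln_gt0 // => lnx.
by rewrite -ler_ln ?posrE ?exprn_gt0 // lnXn // -mulr_natl.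
Qed.

(** Twice the binomial is the falling factorial [(n-1)(n-2)]; the proof reads the factor 2 as [2!]
    to reach it. *)
Lemma bin2_pred_le (R : realType) (n : nat) :
  'C(n.-1, 2)%:R <= n%:R ^+ 2 / 2 :> R.
Proof.
rewrite ler_pdivlMr // -natrX -natrM ler_nat -[X in (_ * X)%N]/(2`!) bin_ffact.
by case: n => [|[|n]] //; rewrite ffactnS ffactn1 /=; nia.
Qed.

Theorem corollary7p1 (R : realType) (m r : nat)
    (hm : (3 <= m)%N) (hr : (1 <= r)%N) :
  central_split_leakage (@power_weight R r) m <= 2 * (2 / 3) ^+ r
  /\
  forall (n : nat) (eps : R), (3 <= n)%N -> 0 < eps ->
    let B : R := 'C(n.-1, 2)%:R in
    [/\ Num.ceil (logb (3 / 2) (128 * B / (eps * n%:R))) <= r%:Z ->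
          central_split_leakage (@power_weight R r) m * B <= eps * n%:R / 64,
        B <= n%:R ^+ 2 / 2
      & Num.ceil (logb (3 / 2) (64 * n%:R / eps)) <= r%:Z ->
          central_split_leakage (@power_weight R r) m * B <= eps * n%:R / 64].
Proof.
have leakle := @power_leakage_le R m r (ltnW (ltnW hm)).
split=> // n eps n3 eps0 B.
have n0 : 0 < n%:R :> R by rewrite ltr0n; lia.
have B0 : 0 < B by rewrite ltr0n bin_gt0; lia.
have Ble : B <= n%:R ^+ 2 / 2 by exact: bin2_pred_le.
have en0 : 0 < eps * n%:R by exact: mulr_gt0.
have b1 : 1 < 3 / 2 :> R by lra.
(* The constant is [128 = 2 * 64]: the 2 counts the two summands of the leakage. *)
have suff_pow : 128 * B / (eps * n%:R) <= (3 / 2) ^+ r ->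
    central_split_leakage (@power_weight R r) m * B <= eps * n%:R / 64.
  move=> h; apply: le_trans (ler_wpM2r (ltW B0) leakle) _.
  have q0 : 0 < (3 / 2 : R) ^+ r by rewrite exprn_gt0 // (lt_trans _ b1).
  rewrite -[2 / 3]invf_div exprVn.
  rewrite ler_pdivrMr // in h.
  by rewrite mulrAC ler_pdivrMr //; lra.
split=> // hceil; apply: suff_pow.
  apply: ceil_logb_le_expr hceil => //.
  by rewrite divr_gt0 // mulr_gt0.
apply: le_trans (ceil_logb_le_expr b1 _ hceil).
  (* Clearing [eps n] leaves [128 B <= 64 n^2], which is [Ble] scaled. *)
  rewrite ler_pdivrMr //.
  have -> : 64 * n%:R / eps * (eps * n%:R) = 64 * n%:R ^+ 2.
    by field; rewrite gt_eqF.
  by lra.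
by rewrite divr_gt0 // mulr_gt0.
Qed.
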